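(* Let $\{\omega_\cdot^{D_\lambda}\}_{\lambda\in\Lambda}$ be a regular closed Radon harmonic measure system on a first-countable Hausdorff space $X$. Suppose $D\in\{D_\lambda\}$ is regular, $\partial D$ is compact, $x_0\in D$, and the relative kernel $K_D^{x_0}$ is (has a version that is) jointly continuous on $D\times\partial D$. Then, for each $y\in\partial D$, $K_D^{x_0}(\cdot,y)$ is strictly positive and harmonic in $D$, and $K_D^{x_0}(x_0,y)=1$.
   Context: $X$ is a first-countable Hausdorff space. A domain is a nonempty connected open set; every domain carrying harmonic measures has nonempty boundary. $V\Subset U$ means that $\overline V$ is compact and contained in $U$. A harmonic measure on a domain $D$ is a family $\{\omega_x^D:x\in D\}$ of (completed) positive Borel measures on $\partial D$ with $\omega_x^D(\partial D)=1$ and $\omega_x^D\ll\omega_y^D$ for all $x,y\in D$. Put $L(\partial D;\omega_\cdot^D)=\bigcap_{x\in D}L^1(\partial D,\omega_x^D)$ and $\omega_x^D(f)=\int_{\partial D}f\,d\omega_x^D$ for $x\in D$, and, by convention, $\omega_y^D(f)=f(y)$ for $y\in\partial D$. It is continuous if $x\mapsto\omega_x^D(f)$ is continuous on $D$ for every $f\in L(\partial D;\omega_\cdot^D)$. $D$ is regular if for every $\zeta\in\partial D$ and every bounded Borel $f$ on $\partial D$ continuous at $\zeta$, $\omega_x^D(f)\to f(\zeta)$ as $D\ni x\to\zeta$. A harmonic measure system is a family of continuous harmonic measures on domains such that for all domains $D,\widetilde D$ in the system with nonempty intersection and all $f\in L(\partial D;\omega_\cdot^D)$, $\widetilde f\in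 L(\partial\widetilde D;\omega_\cdot^{\widetilde D})$ satisfying $\omega_\cdot^{\widetilde D}(\widetilde f)=f$ on $\widetilde D\cap\partial D$ and $\omega_\cdot^D(f)=\widetilde f$ on $\partial\widetilde D\cap\overline D$, one has $\omega_\cdot^D(f)=\omega_\cdot^{\widetilde D}(\widetilde f)$ on $D\cap\widetilde D$. It is Radon if all its measures are Radon, and regular closed if every domain in the system is the union of an increasing sequence of regular domains in the system, each with compact closure contained in the given domain. A function $u:U\to\mathbb R$ on an open set $U\subseteq X$ is harmonic in $U$ if it is continuous and $u(x)=\int_{\partial V}u\,d\omega_x^V$ for every regular $V$ in the system with $V\Subset U$ and every $x\in V$. The relative kernel is $K_D^{x_0}(x,y)=\frac{d\omega_x^D}{d\omega_{x_0}^D}(y)$, $x\in D$, $y\in\partial D$; when a continuous version exists, that version is used. *)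

(* Defs.v *)
From HB Require Import structures.
From mathcomp Require Import all_boot all_order all_algebra.
From mathcomp Require Import all_classical all_reals all_analysis.
Import Order.TTheory GRing.Theory Num.Theory.
Import numFieldNormedType.Exports.

Set Implicit Arguments.
Unset Strict Implicit.
Unset Printing Implicit Defensive.

Local Open Scope classical_set_scope.
Local Open Scope ring_scope.

(* The spaces below are pointed only because [measurableType] requires it. *)

Section Topology.
Context {X : ptopologicalType}.

Definition first_countable := forall x : X, exists B : set (set X),
  [/\ countable B, B `<=` nbhs x &
      forall U, nbhs x U -> exists2 V, B V & V `<=` U].

Definition boundary (D : set X) : set X := closure D `\` D°.

Definition domain (D : set X) := [/\ D !=set0, connected D & open D].

Definition compactly_contained (V U : set X) :=
  compact (closure V) /\ closure V `<=` U.

Definition borel := g_sigma_algebraType (@open X).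

End Topology.
Arguments first_countable X : clear implicits.
Arguments borel X : clear implicits.

Section HarmonicMeasure.
Context {R : realType} {X : ptopologicalType}.

(* A Borel probability measure on the closed set [boundary D] is encoded as a
   Borel probability measure on [X] giving mass 1 to [boundary D], and a
   function on [boundary D] as a function on [X], of which only the values on
   [boundary D] are used. A harmonic measure on [D] is a total function of
   [x : X], of which only the values at [x] in [D] are used.

   Integrals are taken against the completed measure: for a finite [mu], the
   Caratheodory extension [completed_measure_extension mu] is exactly the
   completion of [mu]. *)

Local Notation completion mu := (@completed_measure_extension _ _ _ mu).

Definition hm_L (D : set X) (w : X -> probability (borel X) R) : set (X -> R) :=
  [set f | forall x, D x ->
    (completion (w x)).-integrable (boundary D) (EFin \o f)].

Definition hm_int (D : set X) (w : X -> probability (borel X) R)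
    (f : X -> R) (x : X) : R :=
  \int[completion (w x)]_(y in boundary D) f y.

(* [hm_int] extended to the closure of [D] by the convention that it is [f] on
   [boundary D]. *)
Definition hm_ext (D : set X) (w : X -> probability (borel X) R)
    (f : X -> R) (x : X) : R :=
  if x \in D then hm_int D w f x else f x.

Record harmonic_measure (D : set X) (w : X -> probability (borel X) R) : Prop :=
  HarmonicMeasure {
    hm_domain : domain D ;
    hm_boundary : boundary D !=set0 ;
    hm_total : forall x, D x -> w x (boundary D) = 1%E ;
    hm_dominates : forall x y, D x -> D y -> w x `<< w y }.

Definition continuous_hm (D : set X) (w : X -> probability (borel X) R) :=
  forall f, hm_L D w f -> {within D, continuous (hm_int D w f)}.

Definition regular_domain (D : set X) (w : X -> probability (borel X) R) :=
  forall (z : X) (f : X -> R), boundary D z ->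
    [bounded f y | y in boundary D] ->
    measurable_fun (boundary D : set (borel X)) (f : borel X -> R) ->
    f y @[y --> within (boundary D) (nbhs z)] --> f z ->
    hm_int D w f x @[x --> within D (nbhs z)] --> f z.

Definition radon_measure (mu : {measure set (borel X) -> \bar R}) :=
  (forall x : X, exists2 U : set X, open_nbhs x U & (mu U < +oo)%E) /\
  (forall E : set (borel X), measurable E ->
    mu E = ereal_sup [set mu C | C in [set C : set X | compact C /\ C `<=` E]]).

(* [K x] is, for every [x] in [D], a version on [boundary D] of the
   Radon-Nikodym derivative of [w x] with respect to [w x0]. *)
Definition relative_kernel (D : set X) (w : X -> probability (borel X) R)
    (x0 : X) (K : X -> X -> R) :=
  forall x, D x ->
    ae_eq (w x0) (boundary D)
      (Radon_Nikodym (charge_of_finite_measure (w x)) (w x0)) (EFin \o K x).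

Section System.
Context {I : Type}.
Variables (D : I -> set X) (w : I -> X -> probability (borel X) R).

Record harmonic_measure_system : Prop := HarmonicMeasureSystem {
  hms_hm : forall i, harmonic_measure (D i) (w i) ;
  hms_continuous : forall i, continuous_hm (D i) (w i) ;
  hms_compatible : forall i j (f g : X -> R), D i `&` D j !=set0 ->
    hm_L (D i) (w i) f -> hm_L (D j) (w j) g ->
    (forall x, (D j `&` boundary (D i)) x -> hm_ext (D j) (w j) g x = f x) ->
    (forall x, (boundary (D j) `&` closure (D i)) x ->
       hm_ext (D i) (w i) f x = g x) ->
    forall x, (D i `&` D j) x ->
      hm_ext (D i) (w i) f x = hm_ext (D j) (w j) g x }.

Definition radon_system := forall i x, D i x -> radon_measure (w i x).

Definition regular_closed := forall i, exists s : nat -> I,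
  [/\ forall n, regular_domain (D (s n)) (w (s n)),
      forall n, D (s n) `<=` D (s n.+1),
      forall n, compactly_contained (D (s n)) (D i) &
      D i = \bigcup_n D (s n)].

(* Meant for open [U]. *)
Definition harmonic_in (U : set X) (u : X -> R) :=
  {within U, continuous u} /\
  forall j, regular_domain (D j) (w j) -> compactly_contained (D j) U ->
    forall x, D j x -> u x = hm_int (D j) (w j) u x.

End System.

End HarmonicMeasure.

(* Main.v *)
Require Import Defs.
From mathcomp Require Import all_boot all_order all_algebra.
From mathcomp Require Import all_classical all_reals all_analysis.
From mathcomp Require Import measurable_realfun.
Import Order.TTheory GRing.Theory Num.Theory.
Import numFieldNormedType.Exports.

Set Implicit Arguments.
Unset Strict Implicit.
Unset Printing Implicit Defensive.

Local Open Scope classical_set_scope.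
Local Open Scope ring_scope.

(** Write [B] for the boundary of [D] and [m x] for the [w x]-measure of a
    small neighbourhood [N] of [y] in [B]. Three facts carry the proof.

    First, [w x0] charges every nonempty relatively open subset of [B]
    ([regular_full_support]): by regularity, [w x] of such a set tends to 1
    when [x] tends to one of its points, and all the [w x] have the same null
    sets. Hence [m x0 > 0].

    Second, [m x / m x0] approximates [K x y] ([kernel_approx]), uniformly for
    [x] in a given compact subset of [D]: integrate the density [K x] over a
    neighbourhood [N] on which, by joint continuity and compactness, [K x]
    varies by less than a given [e] for all these [x] at once. With [x = x0]
    this gives [K x0 y = 1], and in general [K x y >= 0].

    Third, [x |-> m x] has the mean value property on every domain [V] of the
    system compactly contained in [D] ([hm_int_mean_value]): the compatibility
    axiom applies to the indicator of [N] on [B] and to [m] on the boundary of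
    [V], because [V] does not meet [B]. Dividing by [m x0] and letting [e] tend
    to 0 transfers the property to [K _ y] ([kernel_mean_value]). Passing to
    this limit replaces the exchange of two integrals, which would require the
    measurability of [K] for a product of Borel sigma-algebras.

    Strict positivity is a minimum principle. If [K x y = 0], choose in the
    exhaustion of [D] a regular [V] that contains both [x] and [x0]. The
    nonnegative function [K _ y] has integral 0 over the boundary of [V] for
    the measure at [x], so it vanishes almost everywhere there, also for the
    measure at [x0]; then [K x0 y = 0], contradicting [K x0 y = 1]. *)

(** * Topological and measure-theoretic preliminaries *)

(** The estimate holds on a neighbourhood of each point [(x, y)] with [x] in
    [C]; finitely many of these neighbourhoods cover [C], so one neighbourhood
    [U] of [y] serves for all [x]. *)
Lemma tube_variation {R : realType} {X Y : topologicalType}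
    (f : X -> Y -> R) (C D : set X) (B : set Y) (y : Y) (e : R) :
  compact C -> C `<=` D -> B y ->
  {within D `*` B, continuous (fun p : X * Y => f p.1 p.2)} -> 0 < e ->
  exists U, [/\ open U, U y &
    forall x t, C x -> U t -> B t -> `|f x t - f x y| < e].
Proof.
move=> cC CD By /subspace_continuousP cf e0.
have /near_covering_withinP covC := (compact_near_coveringP C).1 cC.
suff : \forall t \near within B (nbhs y),
    C `<=` (fun x => `|f x t - f x y| < e).
  rewrite /within/= nearE nbhsE => -[U [oU Uy] UP].
  by exists U; split => // x t Cx Ut Bt; exact: UP.
apply: (covC Y (within B (nbhs y)) (fun t x => `|f x t - f x y| < e)) => x Cx.
have /cvgrPdist_lt/(_ _ (divr_gt0 e0 (ltr0n _ 2))) :=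
  cf (x, y) (conj (CD _ Cx) By).
rewrite /= => -[[U1 U2] /= [U1x U2y] U12].
exists (U1, U2 `&` B) => /=.
  by split => //; apply: (filterS _ U2y) => t U2t Bt; split.
move=> [x' t] /= [U1x' [U2t Bt]] Cx'.
have near_e s : U2 s -> B s -> `|f x y - f x' s| < e / 2.
  by move=> U2s Bs; apply: (U12 (x', s)) => //; split => //; exact: CD.
rewrite -(subrKA (f x y)) (splitr e) (le_lt_trans (ler_normD _ _))//.
by rewrite ltrD// ?near_e// 1?distrC ?near_e//; exact: nbhs_singleton U2y.
Qed.

Section boundaries_and_borel_sets.
Context {X : ptopologicalType}.
Implicit Types A B U : set X.

Lemma closed_boundary A : closed (boundary A).
Proof.
by apply: closedI; [exact: closed_closure|exact/open_closedC/open_interior].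
Qed.

Lemma boundary_subset_closure A : boundary A `<=` closure A.
Proof. by move=> z []. Qed.

Lemma compact_boundary A B :
  compactly_contained A B -> compact (boundary A).
Proof.
move=> [cA _]; apply: subclosed_compact cA _; first exact: closed_boundary.
exact: boundary_subset_closure.
Qed.

Lemma boundary_subset A B : compactly_contained A B -> boundary A `<=` B.
Proof.
by move=> [_]; apply: subset_trans; exact: boundary_subset_closure.
Qed.

Lemma open_borel U : open U -> measurable (U : set (borel X)).
Proof. exact: sub_sigma_algebra. Qed.

Lemma measurable_boundary A : measurable (boundary A : set (borel X)).
Proof.
rewrite -[boundary A]setCK; apply: measurableC; apply: open_borel.
exact/closed_openC/closed_boundary.
Qed.

Lemma measurable_openI_boundary U A :
  open U -> measurable (U `&` boundary A : set (borel X)).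
Proof.
by move=> oU; apply: measurableI; [exact: open_borel|exact: measurable_boundary].
Qed.

Lemma within_continuous_borel {R : realType} A (f : X -> R) :
  measurable (A : set (borel X)) -> {within A, continuous f} ->
  measurable_fun (A : set (borel X)) (f : borel X -> R).
Proof.
move=> mA /continuousP cf; apply: (measurability _ (RGenOpens.measurableE R)).
move=> _ [_ [a [b ->] <-]].
have /open_subspaceP[V oV VA] :=
  cf _ (@interval_open _ (BRight a) (BLeft b) isT isT).
by rewrite setIC -VA; apply: measurableI => //; exact: open_borel.
Qed.

Lemma measurable_indic_open {R : realType} A U : open U ->
  measurable_fun (A : set (borel X)) (\1_U : borel X -> R).
Proof. by move=> oU; apply: measurable_indic; exact: open_borel. Qed.

Lemma bounded_indic {R : realType} A U : [bounded \1_U y : R | y in A].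
Proof.
exists 1; split; first by rewrite num_real.
move=> r r1 z _ /=; rewrite indicE.
by case: (_ \in _); rewrite ?normr1 ?normr0 ltW// (lt_trans _ r1).
Qed.

End boundaries_and_borel_sets.

Section completion.
Context {d} {T : measurableType d} {R : realType}.
Variable mu : {measure set T -> \bar R}.
Local Notation completion := (@completed_measure_extension _ _ _ mu).
Local Notation cara := (caratheodory_type (mu^*)%mu).

Lemma measurable_completion (A : set T) :
  measurable A -> measurable (A : set cara).
Proof. exact: caratheodory_measurable_mu_ext. Qed.

Lemma completionE (A : set T) : measurable A -> completion A = mu A.
Proof. exact: measurable_mu_extE. Qed.

Lemma measurable_fun_completion {d'} {U : measurableType d'} (A : set T)
    (f : T -> U) : measurable A -> measurable_fun A f ->
  measurable_fun (A : set cara) (f : cara -> U).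
Proof.
by move=> mA mf _ B mB; apply: measurable_completion; exact: mf.
Qed.

End completion.

Lemma density_approx {d} {T : measurableType d} {R : realType}
    (nu mu : {finite_measure set T -> \bar R}) (g : T -> R) (B N : set T)
    (c e : R) :
  nu `<< mu ->
  ae_eq mu B (Radon_Nikodym (charge_of_finite_measure nu) mu) (EFin \o g) ->
  measurable N -> N `<=` B -> (forall t, N t -> `|g t - c| <= e) -> 0 <= e ->
  `|fine (nu N) - c * fine (mu N)| <= e * fine (mu N).
Proof.
move=> numu gE mN NB gN e0.
set h := Radon_Nikodym _ _ in gE.
have hint : mu.-integrable N h.
  by apply: (integrableS measurableT) => //; exact: Radon_Nikodym_integrable.
have cint : mu.-integrable N (cst c%:E).
  by apply/finite_measure_integrable_cst.
have nuE : nu N = (\int[mu]_(t in N) h t)%E.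
  by rewrite -Radon_Nikodym_integral.
have diffE : (nu N - c%:E * mu N = \int[mu]_(t in N) (h t - c%:E))%E.
  by rewrite nuE -integral_cst// -integralB.
have mhc : measurable_fun N (fun t => h t - c%:E)%E.
  by apply: emeasurable_funB => //; exact: measurable_int hint.
have : (`|nu N - c%:E * mu N| <= e%:E * mu N)%E.
  rewrite diffE (le_trans (le_abse_integral _ _ _))//.
  apply: integral_le_bound => //.
  case: gE => Z [mZ Z0 BZ]; exists Z; split => // t /= nt; apply: BZ => /= Bt.
  by apply: nt => Nt; rewrite (Bt (NB _ Nt)) lee_fin; exact: gN.
rewrite -(fineK (fin_num_measure nu N mN)) -(fineK (fin_num_measure mu N mN)).
by rewrite -!EFinM -EFinB abse_EFin lee_fin.
Qed.

(** * Harmonic measures *)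

Section harmonic_measures.
Context {R : realType} {X : ptopologicalType}.
Variables (D : set X) (w : X -> probability (borel X) R).
Hypothesis hm : harmonic_measure D w.
Local Notation completion mu := (@completed_measure_extension _ _ _ mu).

Lemma measurable_boundary_completion x :
  measurable (boundary D : set (caratheodory_type ((w x)^*)%mu)).
Proof. by apply: measurable_completion; exact: measurable_boundary. Qed.

Lemma completion_boundary x : D x -> completion (w x) (boundary D) = 1%E.
Proof.
move=> Dx; rewrite -(hm_total hm Dx).
by apply: completionE; exact: measurable_boundary.
Qed.

Lemma hm_L_bounded (f : X -> R) :
  measurable_fun (boundary D : set (borel X)) (f : borel X -> R) ->
  [bounded f y | y in boundary D] -> hm_L D w f.
Proof.
move=> mf bf x Dx; apply: measurable_bounded_integrable => //.
- exact: measurable_boundary_completion.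
- by rewrite [X in (X < _)%E](completion_boundary Dx) ltry.
- by apply: measurable_fun_completion => //; exact: measurable_boundary.
Qed.

Lemma hm_L_continuous (f : X -> R) : compact (boundary D) ->
  {within boundary D, continuous f} -> hm_L D w f.
Proof.
move=> cD cf; apply: hm_L_bounded.
  by apply: within_continuous_borel => //; exact: measurable_boundary.
have /compact_bounded[M [_ Mf]] := continuous_compact cf cD.
exists M; split; rewrite ?num_real // => r Mr z Dz.
by apply: (Mf r Mr); exists z.
Qed.

Lemma hm_L_indic (U : set X) : open U -> hm_L D w \1_U.
Proof.
move=> oU; apply: hm_L_bounded; first exact: measurable_indic_open.
exact: bounded_indic.
Qed.

Lemma hm_int_indic (U : set X) x : open U ->
  hm_int D w \1_U x = fine (w x (U `&` boundary D)).
Proof.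
move=> oU; rewrite /hm_int /Rintegral integral_indic.
- by congr fine; apply: completionE; exact: measurable_openI_boundary.
- exact: measurable_boundary_completion.
- by apply: measurable_completion; exact: open_borel.
Qed.

Lemma hm_int_approx (f g : X -> R) e x : hm_L D w f -> hm_L D w g ->
  (forall z, boundary D z -> `|f z - g z| <= e) -> D x ->
  `|hm_int D w f x - hm_int D w g x| <= e.
Proof.
move=> Lf Lg fge Dx; have mD := measurable_boundary_completion x.
rewrite /hm_int -RintegralB//; [|exact: Lf|exact: Lg].
have fgint : (completion (w x)).-integrable (boundary D)
    (EFin \o (fun z => f z - g z)).
  exact: (integrableB mD (Lf _ Dx) (Lg _ Dx)).
rewrite (le_trans (le_normr_Rintegral _ _))//.
have -> : e = \int[completion (w x)]_(_ in boundary D) e.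
  rewrite Rintegral_cst// [X in fine X](completion_boundary Dx).
  by rewrite mulr1.
apply: le_Rintegral => //.
  exact: integrable_norm.
apply: measurable_bounded_integrable => //.
  by rewrite [X in (X < _)%E](completion_boundary Dx) ltry.
exact: bounded_cst.
Qed.

(** A nonnegative function with integral 0 vanishes almost everywhere, and the
    measures at [x] and [y] have the same null sets. Mutual absolute continuity
    concerns the Borel measures and the integrals their completions, which is
    why [f] is Borel: the set where it does not vanish is then Borel too. *)
Lemma hm_int_eq0 (f : X -> R) x y : hm_L D w f ->
  measurable_fun (boundary D : set (borel X)) (f : borel X -> R) ->
  (forall z, boundary D z -> 0 <= f z) -> D x -> D y ->
  hm_int D w f x = 0 -> hm_int D w f y = 0.
Proof.
move=> Lf mf f0 Dx Dy fx0.
pose N : set (borel X) := boundary D `&` [set z | f z != 0].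
have mN : measurable N.
  have -> : N = boundary D `&` f @^-1` (~` [set 0]).
    by apply/seteqP; split => z [Bz /= fz]; split => //; exact/eqP.
  by apply: mf => //; [exact: measurable_boundary|exact: measurableC].
have mDc := measurable_boundary_completion.
have mfE t : measurable_fun
    (boundary D : set (caratheodory_type ((w t)^*)%mu)) (EFin \o f).
  apply/measurable_EFinP.
  by apply: measurable_fun_completion => //; exact: measurable_boundary.
have absE t : (\int[completion (w t)]_(z in boundary D) `|(f z)%:E| =
    \int[completion (w t)]_(z in boundary D) (f z)%:E)%E.
  apply: eq_integral => z; rewrite inE => Bz.
  by rewrite gee0_abs// lee_fin f0.
have cN t : completion (w t) N = w t N by exact: completionE.
have wxN : w x N = 0%E.
  have intx0 : (\int[completion (w x)]_(z in boundary D) `|(f z)%:E| = 0)%E.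
    rewrite absE -[LHS]fineK; first exact: (congr1 EFin fx0).
    exact: (integrable_fin_num (mDc x) (Lf _ Dx)).
  have [Z [mZ Z0 subZ]] := (ae_eq_integral_abs _ (mDc x) (mfE x)).1 intx0.
  rewrite -cN; apply: (subset_measure0 _ mZ) Z0.
    exact: measurable_completion.
  by move=> z [Bz /= /eqP fz]; apply: subZ => /= /(_ Bz) [].
have wyN : w y N = 0%E.
  exact: (null_content_dominatesP _ _).1 (hm_dominates hm Dy Dx) N mN wxN.
rewrite /hm_int /Rintegral -absE (ae_eq_integral_abs _ (mDc y) (mfE y)).2//.
exists N; split; [exact: measurable_completion|exact: etrans (cN y) wyN|].
move=> z /= /not_implyP[Bz fz]; split => //=.
by apply/eqP; apply: contra_not fz => ->.
Qed.

(** By regularity, [w x U] tends to 1 as [x] tends to [z] in [D], so it is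
    nonzero for some [x] in [D], hence for all. *)
Lemma regular_full_support (U : set X) z y : regular_domain D w ->
  open U -> U z -> boundary D z -> D y -> 0 < fine (w y (U `&` boundary D)).
Proof.
move=> regD oU Uz Bz Dy.
have mN := measurable_openI_boundary D oU.
have Uz1 : \1_U z = 1 :> R by rewrite indicE mem_set.
have : \1_U t @[t --> within (boundary D) (nbhs z)] --> (\1_U z : R).
  rewrite Uz1; apply: cvg_near_cst; apply: (@filterS _ _ _ U).
    by move=> t Ut; rewrite indicE mem_set.
  apply: (@filterS _ (nbhs z) _ U) => //; exact: open_nbhs_nbhs.
move=> /(regD z _ Bz (bounded_indic _ _) (measurable_indic_open oU)).
rewrite Uz1 => /cvgr_gt /(_ _ ltr01) posz.
have [x [Dx posx]] := Bz.1 _ posz.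
have {posx} : 0 < hm_int D w \1_U x by exact: posx.
rewrite hm_int_indic// => wxN.
rewrite lt_neqAle fine_ge0 ?andbT//; apply: contraTneq wxN => wyN.
have wyN0 : w y (U `&` boundary D) = 0%E.
  by rewrite -[LHS]fineK ?fin_num_measure// -wyN.
have -> // : w x (U `&` boundary D) = 0%E.
  exact: (null_content_dominatesP _ _).1 (hm_dominates hm Dx Dy) _ mN wyN0.
by rewrite ltxx.
Qed.

End harmonic_measures.

(** The compatibility axiom for [f] on [D i] and [hm_int (D i) (w i) f] on
    [D j]: the condition on [D j `&` boundary (D i)] is void because [D i] is
    open and contains [D j], and the other one holds by the choice of the
    second function, which is integrable because it is continuous on the
    compact [boundary (D j)]. *)
Lemma hm_int_mean_value {R : realType} {X : ptopologicalType} {I : Type}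
    (D : I -> set X) (w : I -> X -> probability (borel X) R)
    (i j : I) (f : X -> R) (x : X) :
  harmonic_measure_system D w ->
  hm_L (D i) (w i) f -> compactly_contained (D j) (D i) -> D j x ->
  hm_L (D j) (w j) (hm_int (D i) (w i) f) /\
  hm_int (D i) (w i) f x = hm_int (D j) (w j) (hm_int (D i) (w i) f) x.
Proof.
move=> hms Lf ji Djx; have Bji := boundary_subset ji.
have subji : D j `<=` D i by apply: subset_trans ji.2; exact: subset_closure.
have oDi : open (D i) by have [[]] := hms_hm hms i.
have Lg : hm_L (D j) (w j) (hm_int (D i) (w i) f).
  apply: hm_L_continuous; first exact: (hms_hm hms).
    exact: compact_boundary ji.
  by apply: (continuous_subspaceW Bji); exact: (hms_continuous hms Lf).
split => //.
have := @hms_compatible _ _ _ _ _ hms i j f _ _ Lf Lg _ _ x.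
rewrite /hm_ext !mem_set//; [apply=> //|exact: subji].
- by exists x; split => //; exact: subji.
- move=> z [Djz [_ nDiz]]; case: nDiz; rewrite (interior_id _).1//.
  exact: subji.
- by move=> z [Bz _]; rewrite mem_set//; exact: Bji.
- by split => //; exact: subji.
Qed.

(** * The relative kernel *)

Section kernel.
Context {R : realType} {X : ptopologicalType}.
Variables (D : set X) (w : X -> probability (borel X) R).
Hypotheses (hm : harmonic_measure D w) (regD : regular_domain D w).
Variables (x0 : X) (K : X -> X -> R).
Hypotheses (Dx0 : D x0) (KP : relative_kernel D w x0 K).
Hypothesis continuousK :
  {within D `*` boundary D, continuous (fun p : X * X => K p.1 p.2)}.

(** The kernel at [y] is the limit of ratios of harmonic measures of shrinking
    neighbourhoods of [y]. Positive mass at [x0] makes the bound usable after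
    division; uniformity over [C] is what allows integrating it in [x]. *)
Lemma kernel_approx (C : set X) (y : X) (e : R) :
  compact C -> C `<=` D -> boundary D y -> 0 < e ->
  exists2 U, open U & let m x := fine (w x (U `&` boundary D)) in
    0 < m x0 /\ forall x, C x -> `|m x - K x y * m x0| <= e * m x0.
Proof.
move=> cC CD By e0.
have [U [oU Uy Ue]] := tube_variation cC CD By continuousK e0.
exists U => //=; split; first exact: (regular_full_support hm regD oU Uy By).
move=> x Cx; have Dx := CD _ Cx.
apply: (density_approx (hm_dominates hm Dx Dx0) (KP Dx)).
- exact: measurable_openI_boundary.
- by move=> t [].
- by move=> t [Ut Bt]; apply/ltW/Ue.
- exact: ltW.
Qed.

Lemma continuous_kernel y :
  boundary D y -> {within D, continuous (K^~ y)}.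
Proof.
move=> By; apply/subspace_continuousP => x Dx.
have /subspace_continuousP/(_ (x, y) (conj Dx By)) := continuousK.
apply: (@cvg_comp _ _ _ (fun x' => (x', y))) => P [[U1 U2] /= [U1x U2y] UP].
apply: (@filterS _ (nbhs x) _ U1) => // x' U1x' Dx'.
by apply: (UP (x', y)); split => //; exact: nbhs_singleton.
Qed.

Lemma kernel_base y : boundary D y -> K x0 y = 1.
Proof.
move=> By; apply/eqP; rewrite eq_sym -subr_eq0 -normr_le0.
apply/ler_addgt0Pr => e e0.
have [||U _ [m0 /(_ x0 erefl)]] := @kernel_approx [set x0] y e _ _ By e0.
- exact: compact_set1.
- by move=> _ ->.
by rewrite -{1}[fine _]mul1r -mulrBl normrM (gtr0_norm m0) ler_pM2r// add0r.
Qed.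

Lemma kernel_ge0 x y : D x -> boundary D y -> 0 <= K x y.
Proof.
move=> Dx By; apply/ler_addgt0Pr => e e0.
have [||U _ [m0 /(_ x erefl)]] := @kernel_approx [set x] y e _ _ By e0.
- exact: compact_set1.
- by move=> _ ->.
move=> /ler_normlP[_]; rewrite lerBlDr -mulrDl addrC => xm.
by rewrite -(pmulr_lge0 _ m0) (le_trans _ xm)// fine_ge0.
Qed.

End kernel.

Section harmonic_kernel.
Context {R : realType} {X : ptopologicalType} {I : Type}.
Variables (D : I -> set X) (w : I -> X -> probability (borel X) R).
Hypothesis hms : harmonic_measure_system D w.
Variables (i : I) (x0 : X) (K : X -> X -> R).
Hypotheses (regD : regular_domain (D i) (w i)) (Dx0 : D i x0)
  (KP : relative_kernel (D i) (w i) x0 K).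
Hypothesis continuousK :
  {within D i `*` boundary (D i), continuous (fun p : X * X => K p.1 p.2)}.

Lemma continuous_kernel_boundary y j :
  boundary (D i) y -> compactly_contained (D j) (D i) ->
  {within boundary (D j), continuous (K^~ y)}.
Proof.
move=> By ji; apply: (continuous_subspaceW (boundary_subset ji)).
exact: (continuous_kernel continuousK By).
Qed.

Lemma hm_L_kernel y j : boundary (D i) y -> compactly_contained (D j) (D i) ->
  hm_L (D j) (w j) (K^~ y).
Proof.
move=> By ji; apply: hm_L_continuous; first exact: (hms_hm hms).
  exact: compact_boundary ji.
exact: continuous_kernel_boundary.
Qed.

(** The function [u] that integrates the indicator of [U] has the mean value
    property, and [u z] is within [e / 2 * m] of [m * K z y] on the compact
    closure of [D j], where [m = u x0]. Hence [m * K x y] and [m] times the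
    mean of [K^~ y] are each within [e / 2 * m] of [u x]; divide by [m > 0]. *)
Lemma kernel_mean_value y j x : boundary (D i) y ->
  compactly_contained (D j) (D i) -> D j x ->
  K x y = hm_int (D j) (w j) (K^~ y) x.
Proof.
move=> By ji Djx; apply/eqP; rewrite -subr_eq0 -normr_le0.
apply/ler_addgt0Pr => e e0; rewrite add0r.
have e20 : 0 < e / 2 by rewrite divr_gt0.
have [U oU [m0 Um]] := kernel_approx (hms_hm hms i) regD Dx0 KP continuousK
  ji.1 ji.2 By e20.
set m := fine _ in m0 Um.
have Lf := hm_L_indic (hms_hm hms i) oU.
have [Lu uE] := hm_int_mean_value hms Lf ji Djx.
have LK := hm_L_kernel By ji.
have LKm : hm_L (D j) (w j) (fun z => m * K z y).
  move=> z Djz; apply: (integrableZl _ _ (LK _ Djz)).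
  exact: measurable_boundary_completion.
have uK z : closure (D j) z ->
    `|hm_int (D i) (w i) \1_U z - m * K z y| <= e / 2 * m.
  by move=> cz; rewrite hm_int_indic// mulrC; exact: Um.
have := hm_int_approx (hms_hm hms j) Lu LKm
  (fun z Bz => uK z (boundary_subset_closure Bz)) Djx.
have -> : hm_int (D j) (w j) (fun z => m * K z y) x =
    m * hm_int (D j) (w j) (K^~ y) x.
  apply: RintegralZl; last exact: LK.
  exact: measurable_boundary_completion.
rewrite -uE => uint; have := uK _ (subset_closure Djx).
set v := hm_int _ _ \1_U x in uint *; set k := hm_int _ _ _ x in uint * => ux.
rewrite -(ler_pM2r m0) -{1}(gtr0_norm m0) -normrM.
have -> : (K x y - k) * m = (m * K x y - v) + (v - m * k).
  by rewrite subrKA mulrBl !(mulrC m).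
rewrite (le_trans (ler_normD _ _))// [e]splitr mulrDl lerD//.
by rewrite distrC.
Qed.

(** The minimum principle; as the exhaustion increases, one of its members
    contains both [x] and [x0]. *)
Lemma kernel_gt0 y x :
  regular_closed D w -> boundary (D i) y -> D i x -> 0 < K x y.
Proof.
move=> closed_sys By Dx; have K0 z : D i z -> 0 <= K z y.
  by move=> Dz; exact: (kernel_ge0 (hms_hm hms i) regD Dx0 KP).
rewrite lt_neqAle K0// andbT eq_sym; apply/eqP => Kxy.
have [s [_ s_incr sD DE]] := closed_sys i.
have [p _ Dpx] : (\bigcup_n D (s n)) x by rewrite -DE.
have [q _ Dqx0] : (\bigcup_n D (s n)) x0 by rewrite -DE.
have mono : {homo D \o s : a b / (a <= b)%N >-> a `<=` b}.
  by apply: homo_leq => [A|B A C|n];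
    [exact: subset_refl|exact: subset_trans|exact: s_incr].
have ji := sD (maxn p q).
have Vx : D (s (maxn p q)) x by apply: (mono p) => //; exact: leq_maxl.
have Vx0 : D (s (maxn p q)) x0 by apply: (mono q) => //; exact: leq_maxr.
have : K x0 y = 0.
  rewrite (kernel_mean_value By ji Vx0).
  apply: (@hm_int_eq0 _ _ _ _ (hms_hm hms _) _ x) => //.
  - exact: hm_L_kernel.
  - apply: within_continuous_borel; first exact: measurable_boundary.
    exact: continuous_kernel_boundary.
  - by move=> z /(boundary_subset ji); exact: K0.
  - by rewrite -kernel_mean_value.
rewrite (kernel_base (hms_hm hms i) regD Dx0 KP continuousK By).
by move/eqP; rewrite oner_eq0.
Qed.

End harmonic_kernel.

Theorem proposition3p2 (R : realType) (X : ptopologicalType)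
    (hausdorffX : hausdorff_space X) (first_countableX : first_countable X)
    (I : Type) (D : I -> set X) (w : I -> X -> probability (borel X) R)
    (hms : harmonic_measure_system D w)
    (hms_radon : radon_system D w)
    (hms_regular_closed : regular_closed D w)
    (i : I) (regularD : regular_domain (D i) (w i))
    (compact_bdD : compact (boundary (D i)))
    (x0 : X) (Dx0 : D i x0)
    (K : X -> X -> R) (KP : relative_kernel (D i) (w i) x0 K)
    (continuousK : {within D i `*` boundary (D i),
                    continuous (fun p : X * X => K p.1 p.2)})
    (y : X) (bdDy : boundary (D i) y) :
  [/\ forall x, D i x -> 0 < K x y,
      harmonic_in D w (D i) (fun x => K x y) &
      K x0 y = 1].
Proof.
split.
- by move=> x Dx; exact: (kernel_gt0 hms regularD Dx0 KP continuousK).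
- split; first exact: (continuous_kernel continuousK bdDy).
  move=> j _ ji x Djx.
  exact: (kernel_mean_value hms regularD Dx0 KP continuousK).
- exact: (kernel_base (hms_hm hms i) regularD Dx0 KP).
Qed.
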